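(* Let $\mathbb{K}$ be a field of characteristic zero, let $N\ge 2$ and $1\le n\le N+1$. Let $I=\bigcap_{j=1}^{n}\mathfrak{m}_{p_j}\subset \mathbb{K}[\mathbb{P}^N]$ be the ideal of $n$ points $p_1,\dots,p_n$ in general position in $\mathbb{P}^N$. Then for all $r\ge 1$ $$I^{(Nr)}\subset M^{(N-1)r}I^{r}.$$
   Context: $\mathbb{K}[\mathbb{P}^N]=\mathbb{K}[x_0,\dots,x_N]$ with the standard grading, and $M=(x_0,\dots,x_N)$. For a point $p\in\mathbb{P}^N$, $\mathfrak{m}_p$ is the homogeneous ideal generated by the forms vanishing at $p$. The $m$-th symbolic power of $I=\bigcap_{j=1}^n\mathfrak{m}_{p_j}$ (distinct points) is $I^{(m)}=\bigcap_{j=1}^n\mathfrak{m}_{p_j}^{m}$. Convention on general position: the assertion is, for each $r\ge 1$, that there is a nonempty Zariski open subset of $(\mathbb{P}^N)^n$ (which may depend on $r$) such that the containment holds whenever $(p_1,\dots,p_n)$ lies in it. *)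

(* Defs.v *)
(* MathComp world, with multinomials for multivariate polynomials. *)
From HB Require Import structures.
From mathcomp Require Import all_boot all_order all_algebra.
From mathcomp Require Import mpoly.
Set Implicit Arguments.
Unset Strict Implicit.
Unset Printing Implicit Defensive.
Import GRing.Theory.
Local Open Scope ring_scope.

(* Ideals are Prop-valued predicates, since membership in the ideals below
   need not come with a decision procedure. *)

Definition ideal_gen (R : comNzRingType) (S : R -> Prop) : R -> Prop :=
  fun f => exists s : seq (R * R),
    (forall t, t \in s -> S t.2) /\ f = \sum_(t <- s) t.1 * t.2.

Definition ideal_mul (R : comNzRingType) (I J : R -> Prop) : R -> Prop :=
  ideal_gen (fun h => exists f g, [/\ I f, J g & h = f * g]).

Fixpoint ideal_exp (R : comNzRingType) (I : R -> Prop) (m : nat) : R -> Prop :=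
  if m is m'.+1 then ideal_mul (ideal_exp I m') I else fun _ => True.

(* The K-points of P^N, as lines through the origin of K^(N+1). *)
Definition projspace (K : fieldType) (N : nat) : Type :=
  {L : {vspace 'rV[K]_N.+1} | \dim L == 1%N}.

(* For a form f this is the usual vanishing of f at p: the zero vector of the
   line adds no condition, because a form of positive degree vanishes there
   and a constant form has the same value everywhere. *)
Definition vanishes_at (K : fieldType) (N : nat)
    (f : {mpoly K[N.+1]}) (p : projspace K N) : Prop :=
  forall x : 'rV[K]_N.+1, x \in sval p -> f.@[x ord0] = 0.

Definition point_ideal (K : fieldType) (N : nat) (p : projspace K N) :
    {mpoly K[N.+1]} -> Prop :=
  ideal_gen (fun f => (exists d : nat, f \is d.-homog) /\ vanishes_at f p).

Definition points_ideal (K : fieldType) (N n : nat)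
    (p : 'I_n -> projspace K N) : {mpoly K[N.+1]} -> Prop :=
  fun f => forall j, point_ideal (p j) f.

Definition symbolic_power (K : fieldType) (N n : nat)
    (p : 'I_n -> projspace K N) (m : nat) : {mpoly K[N.+1]} -> Prop :=
  fun f => forall j, ideal_exp (point_ideal (p j)) m f.

Definition irrelevant_ideal (K : fieldType) (N : nat) :
    {mpoly K[N.+1]} -> Prop :=
  ideal_gen (fun f => exists i : 'I_N.+1, f = 'X_i).

(* The multigraded coordinate ring of (P^N)^n is {mpoly K[n * N.+1]}: the
   variable of index mxvec_index j i is the i-th homogeneous coordinate of the
   j-th factor. *)
Definition multihomog (K : fieldType) (N n : nat) (d : 'I_n -> nat)
    (F : {mpoly K[n * N.+1]}) : Prop :=
  forall m, m \in msupp F ->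
    forall j : 'I_n, (\sum_(i < N.+1) m (mxvec_index j i))%N = d j.

Definition multivanishes_at (K : fieldType) (N n : nat)
    (F : {mpoly K[n * N.+1]}) (p : 'I_n -> projspace K N) : Prop :=
  forall A : 'M[K]_(n, N.+1),
    (forall j, row j A \in sval (p j)) -> F.@[mxvec A ord0] = 0.

Definition zariski_open (K : fieldType) (N n : nat)
    (U : ('I_n -> projspace K N) -> Prop) : Prop :=
  exists S : {mpoly K[n * N.+1]} -> Prop,
    (forall F, S F -> exists d : 'I_n -> nat, multihomog d F) /\
    (forall p, U p <-> ~ (forall F, S F -> multivanishes_at F p)).

Definition for_general_points (K : fieldType) (N n : nat)
    (P : ('I_n -> projspace K N) -> Prop) : Prop :=
  exists U : ('I_n -> projspace K N) -> Prop,
    [/\ zariski_open U, exists p, U p & forall p, U p -> P p].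

(* Main.v *)
(* In general position the points are linearly independent, so after a linear
   change of coordinates they are coordinate points and every ideal involved is
   monomial. A monomial x^a lies in I^(Nr) iff |a| - a_j >= Nr for each of the n
   points, while I contains the variables vanishing at all the points and the
   products of two distinct variables. Splitting off such factors greedily
   leaves degree at least (N - 1) r after r steps, by summing the n
   inequalities. The open condition is the nonvanishing of the leading n x n
   minor of the matrix of homogeneous coordinates. *)
Require Import Defs.
From HB Require Import structures.
From mathcomp Require Import all_boot all_order all_algebra.
From mathcomp Require Import mpoly.
From mathcomp Require Import perm zify.
Set Implicit Arguments.
Unset Strict Implicit.
Unset Printing Implicit Defensive.
Import GRing.Theory.
Local Open Scope ring_scope.

(** * Generated ideals and their products *)

Section IdealOperations.
Variable R : comNzRingType.
Implicit Types (I J C S : R -> Prop) (f g c : R).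

Lemma ideal_gen_sub S f : S f -> ideal_gen S f.
Proof.
move=> Sf; exists [:: (1, f)]; rewrite big_seq1 mul1r; split=> //.
by move=> t; rewrite inE => /eqP ->.
Qed.

Lemma ideal_gen0 S : ideal_gen S 0.
Proof. by exists [::]; rewrite big_nil. Qed.

Lemma ideal_genD S f g : ideal_gen S f -> ideal_gen S g -> ideal_gen S (f + g).
Proof.
move=> [s [Ss ->]] [t [St ->]]; exists (s ++ t); rewrite big_cat; split=> // u.
by rewrite mem_cat => /orP[/Ss|/St].
Qed.

Lemma ideal_genMl S c f : ideal_gen S f -> ideal_gen S (c * f).
Proof.
move=> [s [Ss ->]]; exists [seq (c * t.1, t.2) | t <- s]; split.
  by move=> _ /mapP[t /Ss St ->].
by rewrite big_map mulr_sumr; apply: eq_bigr => t _; rewrite mulrA.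
Qed.

Lemma ideal_gen_ind S (P : R -> Prop) :
    P 0 -> (forall f g, P f -> P g -> P (f + g)) ->
    (forall c f, S f -> P (c * f)) ->
  forall f, ideal_gen S f -> P f.
Proof.
move=> P0 PD PS _ [s [Ss ->]]; elim: s Ss => [|t s IHs] Ss; first by rewrite big_nil.
rewrite big_cons; apply: PD; first by apply: PS; apply: Ss; rewrite inE eqxx.
by apply: IHs => u us; apply: Ss; rewrite inE us orbT.
Qed.

Lemma ideal_mulP I J f g : I f -> J g -> ideal_mul I J (f * g).
Proof. by move=> If Jg; apply: ideal_gen_sub; exists f, g. Qed.

(** Fits the recursion of [ideal_exp]: with [J] a power of [C], splitting off one factor in [C] on
    the right raises that power by one. *)
Lemma ideal_mul_assocl I J C f g :
  ideal_mul I J f -> C g -> ideal_mul I (ideal_mul J C) (f * g).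
Proof.
move=> IJf Cg; elim/ideal_gen_ind: IJf => [|u v|c _ [u [v [Iu Jv ->]]]].
- by rewrite mul0r; apply: ideal_gen0.
- by rewrite mulrDl; apply: ideal_genD.
by rewrite -!mulrA; apply: ideal_genMl; apply: ideal_mulP => //; apply: ideal_mulP.
Qed.

End IdealOperations.

(** * Monomials in products of ideal powers *)

Section Monomials.
Variables (K : fieldType) (k : nat).
Implicit Types (m : 'X_{1..k}).

Lemma mnm_predK m i : (0 < m i)%N -> m = (m - U_(i) + U_(i))%MM.
Proof.
move=> mi; apply/mnmP => j; rewrite !mnmE; case: eqVneq => [<-|_] /=; lia.
Qed.

Lemma mnm_pos m : (0 < mdeg m)%N -> exists i, (0 < m i)%N.
Proof.
rewrite mdegE => D0; apply/existsP; apply: contraTT D0; rewrite negb_exists => /forallP m0.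
rewrite -leqNgt leqn0 sum_nat_eq0; apply/forallP => i /=.
by have := m0 i; case: (m i).
Qed.

Lemma mnm_coef3_leq m i j l : i != j -> l != i -> l != j ->
  (m i + m j + m l <= mdeg m)%N.
Proof.
move=> ij li lj; rewrite mdegE (bigD1 i) // (bigD1 j) 1?eq_sym //= (bigD1 l) /=; last first.
  by rewrite li lj.
lia.
Qed.

(** * Images of monomials under a ring morphism, later a change of coordinates *)

Section Membership.
Variables (R : comNzRingType) (phi : {rmorphism {mpoly K[k]} -> R}).
Variables (M I : R -> Prop) (n : nat).
Hypothesis M_var : forall i, M (phi 'X_i).
Hypothesis I_var : forall i : 'I_k, (n <= i)%N -> I (phi 'X_i).
Hypothesis I_edge : forall i j : 'I_k, i != j -> I (phi 'X_i * phi 'X_j).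

Lemma mnm_ideal_exp q m : (q <= mdeg m)%N -> ideal_exp M q (phi 'X_[m]).
Proof.
elim: q m => [//|q IHq] m qm /=; have [|i /mnm_predK Em] := @mnm_pos m; first lia.
set m' := (m - _)%MM in Em; rewrite Em mpolyXD rmorphM; apply: ideal_mulP => //; apply: IHq.
by move: qm; rewrite Em mdegD mdeg1; lia.
Qed.

(* Greedy choice: as long as a variable of index >= n is left, it is split off
   as a factor in I; otherwise the product of the two variables of largest
   exponents is. *)
Lemma mnm_ideal_mul q r m :
    (forall j : 'I_k, (j < n)%N -> (r + m j <= mdeg m)%N) ->
    (r.*2 + q <= mdeg m + minn r (\sum_(i < k | n <= i) m i))%N ->
  ideal_mul (ideal_exp M q) (ideal_exp I r) (phi 'X_[m]).
Proof.
(* [HD] is a budget: a variable of index at least [n] costs one degree, a product of two variables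
   costs two, so [r] factors cost [r.*2] minus the number of cheap ones, and degree [q] must
   remain. *)
elim: r m => [|r IHr] m Hj HD.
  rewrite -[phi _]mulr1; apply: ideal_mulP => //; apply: mnm_ideal_exp; lia.
have [/existsP[i /andP[ni mi]]|no_lin] := boolP [exists i : 'I_k, (n <= i) && (0 < m i)]%N.
  have Em := mnm_predK mi; set m' := (m - _)%MM in Em; clearbody m'.
  rewrite Em mpolyXD rmorphM; apply: ideal_mul_assocl; last exact: I_var.
  have dm : mdeg m = (mdeg m').+1 by rewrite Em mdegD mdeg1 addn1.
  have Ej j : (m j = m' j + (i == j))%N by rewrite {1}Em mnmDE mnmE.
  apply: IHr => [j jn|].
    have := Hj j jn; rewrite Ej dm; case: (eqVneq i j) => [ij|_] /=; last lia.
    by move: jn; rewrite -ij ltnNge ni.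
  have : (\sum_(i < k | n <= i) m i = (\sum_(i < k | n <= i) m' i).+1)%N.
    rewrite (bigD1 i) // [in RHS](bigD1 i) //= Ej eqxx addn1 addSn.
    congr (_ + _).+1; apply: eq_bigr => j /andP[_ ji].
    by rewrite Ej eq_sym (negbTE ji) addn0.
  move: HD; lia.
have m_big (i : 'I_k) : (n <= i)%N -> m i = 0%N.
  move=> ni; move: no_lin; rewrite negb_exists => /forallP/(_ i).
  by rewrite ni /=; lia.
rewrite big1 // minn0 addn0 in HD.
have Hj' (j : 'I_k) : (r.+1 + m j <= mdeg m)%N.
  by case: (ltnP j n) => [/Hj //|/m_big ->]; lia.
have [|i0 _] := @mnm_pos m; first lia.
case: (@arg_maxnP _ i0 xpredT m isT) => i _ maxi.
have [j1 /andP[ij1 mj1]] : exists j, (j != i) && (0 < m j)%N.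
  apply/existsP; have := Hj' i; rewrite mdegE (bigD1 i) //=; apply: contraLR.
  rewrite negb_exists => /forallP m0; rewrite big1 ?addn0; first lia.
  by move=> j ji; have := m0 j; rewrite ji /=; lia.
case: (@arg_maxnP _ j1 (fun j => j != i) m ij1) => j ji maxj.
have mj : (0 < m j)%N by apply: leq_trans (maxj _ ij1).
have mi : (0 < m i)%N by apply: leq_trans (maxi j isT).
have Em : m = (m - (U_(i) + U_(j)) + (U_(i) + U_(j)))%MM.
  apply/mnmP => l; rewrite !mnmE.
  by move: mi mj ji; case: (eqVneq i l) => [->|_]; case: (eqVneq j l) => [->|_] /=; rewrite ?eqxx //; lia.
set m' := (m - _)%MM in Em; clearbody m'.
rewrite Em mpolyXD rmorphM; apply: ideal_mul_assocl; last first.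
  by rewrite mpolyXD rmorphM; apply: I_edge; rewrite eq_sym.
have dm : mdeg m = (mdeg m').+2 by rewrite Em !mdegD !mdeg1 addn2.
apply: IHr => [l _|]; last by move: HD; lia.
have El : (m l = m' l + ((i == l) + (j == l)))%N by rewrite {1}Em !mnmDE !mnmE.
have := Hj' l; case: (eqVneq i l) El => [<-|il]; case: (eqVneq j l) => [|jl] /=; try lia.
rewrite eq_sym in il; rewrite eq_sym in jl.
(* For an untouched [l], maximality bounds [m l] by a third of the degree and [HD] bounds [r + 1] by
   half of it; for integers these add up to at most the degree minus one. *)
have := mnm_coef3_leq m ji jl il; have := maxi l isT; have := maxj l il; lia.
Qed.

End Membership.
End Monomials.

(** * Numerical bound on degrees *)

Lemma sum_ord_lt_const k n c : (n <= k)%N -> (\sum_(i < k | i < n) c = n * c)%N.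
Proof.
by move=> nk; rewrite (big_ord_narrow nk) /= sum_nat_const card_ord.
Qed.

(* Summing the n hypotheses gives (n - 1) D + B >= n N r, where D is the total
   degree and B the degree in the variables of index >= n. *)
Lemma symbolic_degree_bound (N n r : nat) (m : 'X_{1..N.+1}) :
    (0 < N)%N -> (0 < n <= N.+1)%N ->
    (forall j : 'I_N.+1, (j < n)%N -> (N * r + m j <= mdeg m)%N) ->
  (r.*2 + (N - 1) * r <= mdeg m + minn r (\sum_(i < N.+1 | n <= i) m i))%N.
Proof.
move=> N0 /andP[n0 nN] Hj; set B := (\sum_(i < _ | _) _)%N.
have D0 : (N * r <= mdeg m)%N by have := Hj ord0 n0; lia.
have ED : mdeg m = (\sum_(i < N.+1 | i < n) m i + B)%N.
  rewrite mdegE (bigID (fun i : 'I_N.+1 => (i < n)%N)) /=; congr addn.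
  by apply: eq_bigl => i; rewrite -leqNgt.
have : (\sum_(i < N.+1 | i < n) (N * r + m i) <= \sum_(i < N.+1 | i < n) mdeg m)%N.
  by apply: leq_sum => i /Hj.
rewrite big_split /= !sum_ord_lt_const //.
move: ED D0 n0 nN N0; set A := (\sum_(i < _ | _) _)%N; move: (mdeg m) A B => D A B.
case: N {m Hj} => // N; case: n => // n -> D0 _ nN _; rewrite subn1 /=.
(* If the minimum is [r], the claim reduces to [D0]. *)
case: (leqP r B) => rB; first nia.
(* Now B < r. In terms of the original n and N, n = 1 would force B >= N r. For n >= 2, (n - 1)(D +
   B) >= n N r >= (n - 1)(N + 1) r, the last step being n <= N + 1. *)
case: n nN => [|n] nN H; nia.
Qed.

(** * Order of a polynomial for an additive weight on monomials *)

Section Order.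
Variables (K : fieldType) (k : nat) (w : 'X_{1..k} -> nat).
Hypothesis wD : {morph w : a b / (a + b)%MM >-> (a + b)%N}.

(** With [w] the degree in all variables but one, this is membership in the [d]-th power of the
    ideal of a coordinate point. *)
Definition order_ge (d : nat) (f : {mpoly K[k]}) : Prop :=
  forall a, a \in msupp f -> (d <= w a)%N.

Lemma order_ge0 d : order_ge d 0.
Proof. by move=> a; rewrite msupp0. Qed.

Lemma order_geD d f g : order_ge d f -> order_ge d g -> order_ge d (f + g).
Proof. by move=> Hf Hg a /msuppD_le; rewrite mem_cat => /orP[/Hf|/Hg]. Qed.

Lemma order_geM d e f g : order_ge d f -> order_ge e g -> order_ge (d + e) (f * g).
Proof.
by move=> Hf Hg _ /msuppM_le/allpairsP[[a b] [/Hf Ha /Hg Hb ->]]; rewrite wD leq_add.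
Qed.

Lemma order_ge_ideal_gen l (phi : {rmorphism {mpoly K[l]} -> {mpoly K[k]}}) S d :
    (forall f, S f -> order_ge d (phi f)) ->
  forall f, ideal_gen S f -> order_ge d (phi f).
Proof.
move=> HS f; elim/ideal_gen_ind => [|g h Hg Hh|c g /HS Hg].
- by rewrite rmorph0; apply: order_ge0.
- by rewrite rmorphD; apply: order_geD.
by rewrite rmorphM; apply: (@order_geM 0).
Qed.

Lemma order_ge_ideal_exp l (phi : {rmorphism {mpoly K[l]} -> {mpoly K[k]}}) I :
    (forall f, I f -> order_ge 1 (phi f)) ->
  forall d f, ideal_exp I d f -> order_ge d (phi f).
Proof.
move=> HI; elim=> [//|d IHd] f /=; apply: order_ge_ideal_gen => _ [g [h [Ig Ih ->]]].
by rewrite rmorphM -addn1; apply: order_geM; [apply: IHd | apply: HI].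
Qed.

End Order.

Lemma comp_mpoly_dhomog (K : fieldType) (k l d : nat) (lq : k.-tuple {mpoly K[l]})
    (f : {mpoly K[k]}) :
    (forall i, tnth lq i \is 1.-homog) -> f \is d.-homog ->
  (f \mPo lq) \is d.-homog.
Proof.
move=> Hlq /dhomogP Hf; rewrite comp_mpolyE big_seq; apply: rpred_sum => a /Hf <-.
apply: rpredZ; rewrite /= mdegE.
apply: (big_ind2 (fun (p : {mpoly K[l]}) e => p \is e.-homog)) => [|p e q e'|i _].
- exact: dhomog1.
- exact: dhomogM.
by have := dhomogMn (a i) (Hlq i); rewrite mul1n.
Qed.

(** * Linear changes of coordinates *)

Section LinearSubstitution.
Variables (K : fieldType) (k : nat).
Implicit Types (A B : 'M[K]_k) (f : {mpoly K[k]}).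

(** Arranged so that substitution is composition with x -> x B on row vectors: the value at the j-th
    basis vector becomes the value at the j-th row of [B]. *)
Definition mx_subst B : k.-tuple {mpoly K[k]} :=
  [tuple \sum_(l < k) B l i *: 'X_l | i < k].

Lemma mx_subst_homog B i : tnth (mx_subst B) i \is 1.-homog.
Proof.
rewrite tnth_mktuple; apply: rpred_sum => l _; apply: rpredZ.
by rewrite dhomogX /= mdeg1.
Qed.

Lemma mx_substX B i : 'X_i \mPo mx_subst B = \sum_(l < k) B l i *: 'X_l.
Proof. by rewrite comp_mpolyXU -tnth_nth tnth_mktuple. Qed.

Lemma mx_subst_comp A B f :
  (f \mPo mx_subst B) \mPo mx_subst A = f \mPo mx_subst (A *m B).
Proof.
rewrite !(comp_mpolyEX f) linear_sum; apply: eq_bigr => a _ /=.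
rewrite linearZ /= !comp_mpolyX rmorph_prod; congr (_ *: _).
apply: eq_bigr => i _; rewrite rmorphXn /= !tnth_mktuple linear_sum /=.
congr (_ ^+ _); under eq_bigr do rewrite linearZ /= mx_substX scaler_sumr.
rewrite exchange_big; apply: eq_bigr => l _ /=; rewrite mxE scaler_suml.
by apply: eq_bigr => j _; rewrite scalerA mulrC.
Qed.

Lemma mx_subst1 f : f \mPo mx_subst 1%:M = f.
Proof.
rewrite -[RHS]comp_mpoly_id; congr comp_mpoly; apply: eq_from_tnth => i.
rewrite !tnth_mktuple (bigD1 i) //= mxE eqxx scale1r big1 ?addr0 // => l li.
by rewrite mxE (negbTE li) scale0r.
Qed.

Lemma mx_substK B f : B \in unitmx ->
  (f \mPo mx_subst B) \mPo mx_subst (invmx B) = f.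
Proof. by move=> Bu; rewrite mx_subst_comp mulVmx // mx_subst1. Qed.

Lemma meval_mx_subst B f (x : 'rV[K]_k) :
  (f \mPo mx_subst B).@[x ord0] = f.@[(x *m B) ord0].
Proof.
rewrite comp_mpoly_meval; apply: meval_eq => i.
rewrite tnth_mktuple raddf_sum mxE; apply: eq_bigr => l _ /=.
by rewrite mevalZ mevalXU mulrC.
Qed.

End LinearSubstitution.

(** * Containment for points spanned by rows of an invertible matrix *)

Section Coordinates.
Variables (K : fieldType) (N n : nat) (nN : (n <= N.+1)%N).
Variables (B : 'M[K]_N.+1) (p : 'I_n -> projspace K N).
Hypothesis Bu : B \in unitmx.
Hypothesis pB : forall j, sval (p j) = <[row (widen_ord nN j) B]>%VS.

(** The order of vanishing of a monomial at the [j]-th coordinate point. *)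
Definition off_degree (j : 'I_N.+1) (a : 'X_{1..N.+1}) : nat :=
  \sum_(i < N.+1 | i != j) a i.

Lemma off_degreeD j : {morph off_degree j : a b / (a + b)%MM >-> (a + b)%N}.
Proof. by move=> a b; rewrite -big_split; apply: eq_bigr => i _; rewrite mnmDE. Qed.

Lemma off_degreeE j a : (off_degree j a + a j = mdeg a)%N.
Proof. by rewrite mdegE (bigD1 j) //= addnC. Qed.

Lemma off_degree_eq0 j a : off_degree j a = 0%N -> a = (U_(j) *+ mdeg a)%MM.
Proof.
move=> a0; have := off_degreeE j a; rewrite a0 add0n => aj; apply/mnmP => i.
rewrite mulmnE mnmE -aj; case: (eqVneq j i) => [->|ji]; first by rewrite mul1n.
apply/eqP; rewrite mul0n -leqn0 -a0 /off_degree (bigD1 i) 1?eq_sym //=; lia.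
Qed.

(** At a basis vector only pure powers of the matching variable survive, and homogeneity leaves one
    of them. *)
Lemma meval_homog_delta d (f : {mpoly K[N.+1]}) (j : 'I_N.+1) :
  f \is d.-homog ->
  f.@[(delta_mx ord0 j : 'rV_N.+1) ord0] = f@_(U_(j) *+ d).
Proof.
move=> /dhomogP Hf; rewrite mevalE.
have E a : a \in msupp f ->
    \prod_i (delta_mx ord0 j : 'rV[K]_N.+1) ord0 i ^+ a i = (a == (U_(j) *+ d)%MM)%:R.
  move=> /Hf <-; case: eqP => [->|/eqP ne].
    rewrite big1 // => i _; rewrite mxE eqxx /= mulmnE mnmE eq_sym.
    by case: eqP; rewrite ?expr1n ?mul0n ?expr0.
  (* Removing all of ['X_j] from the monomial leaves some other variable, which evaluates to 0. *)
  have [|i] := @mnm_pos _ (a - U_(j) *+ a j)%MM.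
    rewrite lt0n mdeg_eq0; apply: contra ne => /eqP Ea.
    apply/eqP/off_degree_eq0/eqP; rewrite sum_nat_eq0; apply/forallP => i.
    apply/implyP => ij; have := congr1 (fun b : 'X_{1..N.+1} => b i) Ea.
    by rewrite mnmBE mulmnE !mnmE eq_sym (negbTE ij) subn0 => ->.
  rewrite mnmBE mulmnE mnmE; case: (eqVneq j i) => [->|ji]; first lia.
  rewrite subn0 => ai; rewrite (bigD1 i) //= mxE eqxx eq_sym (negbTE ji) /=.
  by rewrite expr0n eqn0Ngt ai mul0r.
rewrite big_seq; under eq_bigr => a /E -> do [].
have [fin|fout] := boolP ((U_(j) *+ d)%MM \in msupp f).
  rewrite -big_seq (bigD1_seq _ fin) ?msupp_uniq //= eqxx mulr1 big1 ?addr0 // => a.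
  by move=> /negbTE ->; rewrite mulr0.
rewrite (memN_msupp_eq0 fout) big1 // => a af; case: eqP => [Ea|_]; last by rewrite mulr0.
by rewrite -Ea af in fout.
Qed.

(** After substitution, the coefficient of the pure power in a form is the value of the original
    form at a vector spanning [p j], hence 0. *)
Lemma point_ideal_order j f :
  point_ideal (p j) f ->
  order_ge (off_degree (widen_ord nN j)) 1 (f \mPo mx_subst B).
Proof.
apply: (order_ge_ideal_gen (@off_degreeD _) (phi := comp_mpoly (mx_subst B))).
move=> {}f [[d Hd] Hv] a /= af; rewrite lt0n; apply: contraTN af => /eqP a0.
have Hf := comp_mpoly_dhomog (mx_subst_homog B) Hd.
have [ad|ad] := eqVneq (mdeg a) d; last first.
  by apply: contra ad => /(dhomogP _ _ _ Hf) /= ->.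
rewrite -mcoeff_eq0 (off_degree_eq0 a0) ad -meval_homog_delta // meval_mx_subst.
by rewrite -rowE Hv // pB memv_line.
Qed.

(** The form is the [i]-th coordinate in the basis of rows of [B], so it kills every other row. *)
Lemma dual_form_point i j : i != widen_ord nN j ->
  point_ideal (p j) ('X_i \mPo mx_subst (invmx B)).
Proof.
move=> ij; apply: ideal_gen_sub; split.
  by exists 1%N; rewrite comp_mpolyXU -tnth_nth mx_subst_homog.
move=> x; rewrite pB => /vlineP[c ->]; rewrite meval_mx_subst mevalXU.
rewrite -scalemxAl -row_mul mulmxV // !mxE eq_sym (negbTE ij); exact: mulr0.
Qed.

Lemma dual_form_irrelevant i :
  @irrelevant_ideal K N ('X_i \mPo mx_subst (invmx B)).
Proof.
rewrite mx_substX; apply: big_ind => [|f g|l _]; first exact: ideal_gen0.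
  exact: ideal_genD.
by rewrite -mul_mpolyC; apply: ideal_genMl; apply: ideal_gen_sub; exists l.
Qed.

Lemma symbolic_power_containment r f :
    (0 < N)%N -> (0 < n)%N ->
    symbolic_power p (N * r) f ->
  ideal_mul (ideal_exp (@irrelevant_ideal K N) ((N - 1) * r))
            (ideal_exp (points_ideal p) r) f.
Proof.
(* [f] is expanded into monomials in the dual forms, and each monomial is treated separately. *)
move=> N0 n0 Hf; rewrite -(mx_substK f Bu) [X in X \mPo _]mpolyE linear_sum /=.
rewrite big_seq; apply: big_ind => [|g h|a af]; first exact: ideal_gen0.
  exact: ideal_genD.
have Ha (j : 'I_N.+1) : (j < n)%N -> (N * r + a j <= mdeg a)%N.
  move=> jn; rewrite -(off_degreeE j) leq_add2r.
  have -> : j = widen_ord nN (Ordinal jn) by apply: val_inj.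
  apply: (order_ge_ideal_exp (@off_degreeD _) (phi := comp_mpoly (mx_subst B))) af.
    exact: point_ideal_order.
  exact: Hf.
rewrite linearZ /= -mul_mpolyC; apply: ideal_genMl.
apply: (mnm_ideal_mul (phi := comp_mpoly (mx_subst (invmx B))) (n := n)).
- exact: dual_form_irrelevant.
- move=> i ni j; apply: dual_form_point; apply: contraTneq ni => ->.
  by rewrite -ltnNge /=.
(* At each point at least one of two distinct dual forms vanishes. *)
- move=> i l il j; have [Ei|] := eqVneq i (widen_ord nN j).
    by apply: ideal_genMl; apply: dual_form_point; rewrite -Ei eq_sym.
  by move=> /dual_form_point Hi; rewrite mulrC; apply: ideal_genMl.
- by move=> j /Ha; nia.
by apply: symbolic_degree_bound => //; rewrite n0.
Qed.

End Coordinates.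

(** * The open set where the leading minor is nonzero *)

Section GenericMinor.
Variables (K : fieldType) (N n : nat) (nN : (n <= N.+1)%N).
Let w := widen_ord nN.
Implicit Types (A : 'M[K]_(n, N.+1)) (p : 'I_n -> projspace K N).

Definition generic_minor : {mpoly K[n * N.+1]} :=
  \det (\matrix_(i < n, j < n) 'X_(mxvec_index i (w j))).

Lemma generic_minorE A : generic_minor.@[mxvec A ord0] = \det (colsub w A).
Proof.
rewrite -[LHS]det_map_mx; congr (\det _); apply/matrixP => i j.
by rewrite mxE mxE /= mevalXU mxvecE mxE.
Qed.

(** Each Leibniz term takes exactly one entry from each row, that is, one coordinate of each
    point. *)
Lemma generic_minor_multihomog : multihomog (fun=> 1%N) generic_minor.
Proof.
move=> a /msupp_sum_le/flatten_mapP[s _]; rewrite -signr_odd mulr_sign.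
have -> : \prod_i (\matrix_(i < n, j < n) 'X_(mxvec_index i (w j))) i (s i) =
    'X_[(\sum_i U_(mxvec_index i (w (s i))))%MM] :> {mpoly K[n * N.+1]}.
  by rewrite (big_morph _ (@mpolyXD _ K) (mpolyX0 _ K)); apply: eq_bigr => i _; rewrite mxE.
have -> c (q : {mpoly K[n * N.+1]}) : (a \in msupp (if c then - q else q)) = (a \in msupp q).
  by case: c => //; rewrite (perm_mem (msuppN _)).
rewrite msuppX inE => /eqP -> j.
rewrite (eq_bigr _ (fun i _ => mnm_sumE _ _ _ _)).
have inj_idx (i i' : 'I_n) (l l' : 'I_N.+1) :
    (mxvec_index i l == mxvec_index i' l') = ((i, l) == (i', l')).
  have [g gK _] := @curry_mxvec_bij n N.+1.
  by apply/eqP/eqP => [E|[-> ->] //]; rewrite -[LHS]gK //= E; exact: (gK (_, _)).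
rewrite exchange_big (bigD1 j) //= [X in (_ + X)%N]big1 => [|i ij].
  rewrite addn0 (bigD1 (w (s j))) //= mnmE inj_idx eqxx big1 // => l ls.
  by rewrite mnmE inj_idx xpair_eqE eqxx eq_sym (negbTE ls).
by rewrite big1 // => l _; rewrite mnmE inj_idx xpair_eqE (negbTE ij).
Qed.

Lemma generic_minor_open :
  zariski_open (fun p => ~ multivanishes_at generic_minor p).
Proof.
exists (eq generic_minor); split.
  by move=> _ <-; exists (fun=> 1%N); exact: generic_minor_multihomog.
by move=> p; split=> H H'; apply: H; [exact: H' | move=> _ <-].
Qed.

Lemma projspace_vpick (x : projspace K N) : sval x = <[vpick (sval x)]>%VS.
Proof.
case: x => L /= /eqP dL; apply/esym/eqP; rewrite eqEdim -memvE memv_pick dL dim_vline.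
by rewrite lt0b vpick0 -dimv_eq0 dL.
Qed.

Definition line_mx p : 'M[K]_(n, N.+1) := \matrix_j vpick (sval (p j)).

(** Other vectors on the lines are row multiples of the chosen ones, so if the minor were 0 for the
    chosen ones it would be 0 for all. *)
Lemma line_mx_det p :
  ~ multivanishes_at generic_minor p -> colsub w (line_mx p) \in unitmx.
Proof.
move=> nv; rewrite unitmxE unitfE; apply/eqP => d0; apply: nv => A pA.
have /fin_all_exists[c Ac] j : exists c, row j A = c *: row j (line_mx p).
  by have := pA j; rewrite projspace_vpick rowK => /vlineP.
have -> : A = diag_mx (\row_j c j) *m line_mx p.
  by apply/row_matrixP => j; rewrite Ac mul_diag_mx; apply/rowP => l; rewrite !mxE.
by rewrite generic_minorE -mulmx_colsub det_mulmx d0 mulr0.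
Qed.

Lemma line_mx_inj p : colsub w (line_mx p) \in unitmx -> injective p.
Proof.
rewrite unitmxE unitfE => d0 i j pij; apply/eqP; apply: contraNT d0 => ij.
by apply/eqP; apply: (determinant_alternate ij) => l; rewrite !mxE pij.
Qed.

(** An invertible minor makes the chosen vectors independent, so they extend to a basis. *)
Lemma line_mx_complete p : colsub w (line_mx p) \in unitmx ->
  {B : 'M[K]_N.+1 | B \in unitmx
    & forall j, sval (p j) = <[row (w j) B]>%VS}.
Proof.
move=> du; pose E : 'M[K]_(n, N.+1) := rowsub w 1%:M; set A := line_mx p.
have rank_n (C : 'M[K]_(n, N.+1)) : colsub w C \in unitmx -> \rank C = n.
  move=> Cu; apply/eqP; rewrite -[_ == _]/(row_free C); apply/row_freeP.
  exists (colsub w 1%:M *m invmx (colsub w C)).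
  by rewrite mulmxA mulmx_colsub mulmx1 mulmxV.
have EE : E *m E^T = 1%:M.
  by rewrite mul_rowsub_mx mul1mx; apply/matrixP => i j; rewrite !mxE -(inj_eq val_inj) eq_sym.
have EA : E *m (E^T *m A) = A by rewrite mulmxA EE mul1mx.
(* [E^T *m A] is [A] padded with zero rows. It keeps the rank of [E], so on the row space of [E] it
   agrees with an invertible [B], whose first rows are then those of [A]. *)
have [|B Bu EB] := @complete_unitmx _ _ _ E (E^T *m A).
  rewrite EA !rank_n //; congr (_ \in unitmx): (unitmx1 K n).
  by apply/matrixP => i j; rewrite !mxE.
exists B => // j; rewrite projspace_vpick; congr <[_]>%VS.
by have := congr1 (row j) EB; rewrite EA mul_rowsub_mx mul1mx row_rowsub rowK.
Qed.

(** The first [n] coordinate points have an identity matrix as minor. *)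
Lemma generic_minor_nonvanishing :
  exists p, ~ multivanishes_at generic_minor p.
Proof.
have L1 j : \dim <[delta_mx ord0 (w j) : 'rV[K]_N.+1]>%VS == 1%N.
  rewrite dim_vline eqb1; apply/eqP => /matrixP/(_ ord0 (w j)).
  by rewrite !mxE !eqxx => /eqP; rewrite oner_eq0.
have minor1 : colsub w (rowsub w 1%:M) = 1%:M :> 'M[K]_n.
  by apply/matrixP => i j; rewrite !mxE.
exists (fun j => exist _ <[delta_mx ord0 (w j)]>%VS (L1 j)) => /(_ (rowsub w 1%:M)).
rewrite generic_minorE minor1 det1 => one0.
suff /eqP : (1 : K) = 0 by rewrite oner_eq0.
by apply: one0 => j /=; rewrite row_rowsub row1 memv_line.
Qed.

End GenericMinor.

Theorem theorem4 (K : fieldType) (hK : [pchar K] =i pred0)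
    (N n : nat) (hN : (2 <= N)%N) (hn : (1 <= n <= N.+1)%N)
    (r : nat) (hr : (1 <= r)%N) :
  for_general_points (fun p : 'I_n -> projspace K N =>
    injective p /\
    forall f : {mpoly K[N.+1]},
      symbolic_power p (N * r) f ->
      ideal_mul (ideal_exp (@irrelevant_ideal K N) ((N - 1) * r))
                (ideal_exp (points_ideal p) r) f).
Proof.
have /andP[n0 nN] := hn; have N0 : (0 < N)%N := ltnW hN.
(* The same open set serves every [r]. *)
exists (fun p => ~ multivanishes_at (generic_minor K nN) p); split.
- exact: generic_minor_open.
- exact: generic_minor_nonvanishing.
move=> p /line_mx_det du; split; first exact: line_mx_inj du.
have [B Bu pB] := line_mx_complete du.
by move=> f; apply: symbolic_power_containment Bu pB r f N0 n0.
Qed.
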